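(* Let $I\subseteq\mathbb{R}$ be an interval, let $h:J\to\mathbb{R}$ with $[0,1]\subseteq J\subseteq\mathbb{R}$ be superadditive and nonnegative with $h(\alpha)\ge\alpha$ for all $\alpha\in(0,1)$, and let $f,g\in SX(h,I)$ be similarly ordered on $I$. Let $a,b\in I$ with $a<b$. Then $$\frac{M(a,b)}{6}+\frac{N(a,b)}{3}\le h(1)\left[f(a)g(a)\int_0^1 h(\alpha)\,d\alpha+f(b)g(b)\int_0^1 h(1-\alpha)\,d\alpha\right].$$
   Context: $SX(h,I)$ denotes the class of $h$-convex functions: $f:I\to\mathbb{R}$ belongs to $SX(h,I)$ if $f$ is nonnegative and $f(tx+(1-t)y)\le h(t)f(x)+h(1-t)f(y)$ for all $x,y\in I$ and $t\in[0,1]$. The function $h:J\to\mathbb{R}$ is superadditive if $h(x+y)\ge h(x)+h(y)$ for all $x,y\in J$ (with $x+y\in J$). Functions $f,g$ are similarly ordered on $I$ if $(f(x)-f(y))(g(x)-g(y))\ge 0$ for all $x,y\in I$. Notation: $M(a,b)=f(a)g(a)+f(b)g(b)$ and $N(a,b)=f(a)g(b)+f(b)g(a)$. *)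

(* Defs.v *)
From HB Require Import structures.
From mathcomp Require Import all_boot all_order all_algebra.
From mathcomp Require Import all_classical all_reals all_analysis.

Set Implicit Arguments.
Unset Strict Implicit.
Unset Printing Implicit Defensive.

Import Order.TTheory GRing.Theory Num.Theory.
Import numFieldNormedType.Exports.

Local Open Scope classical_set_scope.
Local Open Scope ring_scope.

(* A function on a subset of R is a total function on R of which only the
   values on that subset are constrained. *)

(* The class SX(h, I), for h defined at least on [0, 1]. *)
Definition h_convex (R : realType) (h : R -> R) (I : set R) (f : R -> R) :
    Prop :=
  (forall x, I x -> 0 <= f x) /\
  (forall x y t, I x -> I y -> 0 <= t <= 1 ->
     f (t * x + (1 - t) * y) <= h t * f x + h (1 - t) * f y).

Definition superadditive (R : realType) (J : set R) (h : R -> R) : Prop :=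
  forall x y, J x -> J y -> J (x + y) -> h x + h y <= h (x + y).

Definition similarly_ordered (R : realType) (I : set R) (f g : R -> R) : Prop :=
  forall x y, I x -> I y -> 0 <= (f x - f y) * (g x - g y).

Definition M (R : realType) (f g : R -> R) (a b : R) : R :=
  f a * g a + f b * g b.

Definition N (R : realType) (f g : R -> R) (a b : R) : R :=
  f a * g b + f b * g a.

(* Main.v *)
Require Import Defs.
From HB Require Import structures.
From mathcomp Require Import all_boot all_order all_algebra.
From mathcomp Require Import all_classical all_reals all_analysis.
From mathcomp Require Import measurable_realfun lra.

Import Order.TTheory GRing.Theory Num.Theory.
Import numFieldNormedType.Exports.

Local Open Scope classical_set_scope.
Local Open Scope ring_scope.

(** Put [A = f a * g a] and [B = f b * g b], which are nonnegative because [f]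
    and [g] are.  Similar ordering at the pair [a, b] reads
    [N f g a b <= M f g a b], so the left-hand side is at most
    [M f g a b / 2 = (A + B) / 2].  On the other side, [t <= h t] on the open
    unit interval makes the integrals of [h t] and of [h (1 - t)] at least
    [1 / 2] each, the common value of the integrals of [t] and of [1 - t], and
    [1 <= h 1] (lemma [nondecreasing_ge1]).

    Comparing integrals requires [h] to be integrable on the unit interval,
    although no regularity is assumed: a nonnegative superadditive function is
    nondecreasing ([superadditive_nondecreasing]), hence measurable and bounded
    there ([nondecreasing_integrable]). *)

(** The increment [h y - h x] is at least [h (y - x)], which is nonnegative. *)
Lemma superadditive_nondecreasing (R : realType) (J : set R) (h : R -> R) :
  `[0, 1] `<=` J -> superadditive J h -> (forall x, J x -> 0 <= h x) ->
  {in `[0, 1] &, {homo h : x y / x <= y}}.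
Proof.
move=> sJ h_superadd h_ge0 x y; rewrite !in_itv /= => /andP[x0 x1] /andP[y0 y1].
move=> xy.
have Jx : J x by apply: sJ; rewrite /= in_itv /= x0.
have Jd : J (y - x) by apply: sJ; rewrite /= in_itv /=; lra.
have Jy : J (x + (y - x)) by rewrite subrKC; apply: sJ; rewrite /= in_itv /= y0.
have := h_superadd _ _ Jx Jd Jy; have := h_ge0 _ Jd.
rewrite subrKC; lra.
Qed.

(** A function that is monotone on a segment is bounded by its endpoint values
    there.  For measurability, precomposing with the retraction of the line
    onto the segment turns [h] into a function that is nondecreasing everywhere,
    hence measurable. *)
Lemma nondecreasing_integrable (R : realType) (h : R -> R) (c d : R) :
  c <= d -> {in `[c, d] &, {homo h : x y / x <= y}} ->
  (@lebesgue_measure R).-integrable `[c, d] (EFin \o h).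
Proof.
move=> cd h_homo.
have in_cd (x : R) : Num.max c (Num.min d x) \in `[c, d].
  by rewrite in_itv /= le_max lexx ge_max cd ge_min lexx.
have bounds (x : R) : x \in `[c, d] -> h c <= h x <= h d.
  move=> xcd; have /andP[cx xd] : c <= x <= d by move: xcd; rewrite in_itv.
  by rewrite !h_homo// in_itv /= lexx cd.
apply: measurable_bounded_integrable => //=.
- by rewrite lebesgue_measure_itv /=; case: ifP => _; rewrite ?ltry.
- apply: (eq_measurable_fun (fun x => h (Num.max c (Num.min d x)))).
    move=> x /set_mem /=; rewrite in_itv /= => /andP[cx xd].
    by rewrite (min_idPr xd) (max_idPr cx).
  apply: nondecreasing_measurable => // x y xy; apply: h_homo => //.
  by rewrite ge_max !le_max lexx /= le_min !ge_min lexx /= xy !orbT.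
- exists (`|h c| + `|h d|); split; first exact: num_real.
  move=> K ltK x /= /bounds /andP[hcx hxd]; apply: le_trans (ltW ltK).
  rewrite ler_norml.
  have := ler_norm (h d); have := ler_norm (- h c); rewrite normrN.
  have := normr_ge0 (h c); have := normr_ge0 (h d); lra.
Qed.

Lemma Rintegral_onem (R : realType) :
  \int[lebesgue_measure]_(t in `[0, 1]) (1 - t) = 2^-1 :> R.
Proof. exact: (Rintegral_onemXn 1). Qed.

Lemma nondecreasing_onem_integrable (R : realType) (h : R -> R) :
  {in `[0, 1] &, {homo h : x y / x <= y}} ->
  (@lebesgue_measure R).-integrable `[0, 1] (EFin \o (fun t => h (1 - t))).
Proof.
move=> h_homo.
have -> : EFin \o (fun t => h (1 - t)) =
    (\- (EFin \o (fun t : R => - h (1 - t)%R)%R))%E.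
  by apply/funext => t /=; rewrite opprK.
apply: integrableN => //; apply: nondecreasing_integrable => // x y.
rewrite !in_itv /= => x01 y01 xy; rewrite lerN2.
by apply: h_homo; rewrite ?in_itv /=; lra.
Qed.

(** The reflection [t |-> 1 - t] preserves the integral over the unit
    interval. *)
Lemma Rintegral_id (R : realType) :
  \int[lebesgue_measure]_(t in `[0, 1]) t = 2^-1 :> R.
Proof.
rewrite -Rintegral_onem Rintegration_by_substitution_onem ?ler01 ?lexx//.
  by rewrite unstable.onem1.
by apply: continuous_subspaceT => x; exact: cvg_id.
Qed.

(** The bound is not given at [1] itself, and [h] need not be continuous there;
    monotonicity carries the bound over.  If [h 1 < 1], the midpoint [t] of
    [h 1] and [1] would satisfy [h 1 < t <= h t <= h 1], where
    [1 / 2 <= h (1 / 2) <= h 1] places this [t] in the open unit interval. *)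
Lemma nondecreasing_ge1 (R : realType) (h : R -> R) :
  {in `[0, 1] &, {homo h : x y / x <= y}} ->
  (forall t, 0 < t < 1 -> t <= h t) -> 1 <= h 1.
Proof.
move=> h_homo h_ge_id; rewrite leNgt; apply/negP => h1_lt1.
have le_h1 (t : R) : 0 < t < 1 -> t <= h 1.
  move=> t01; apply: le_trans (h_ge_id t t01) _.
  by apply: h_homo; rewrite ?in_itv /=; lra.
have h1_ge : 2^-1 <= h 1 by apply: le_h1; lra.
have : (1 + h 1) / 2 <= h 1 by apply: le_h1; lra.
lra.
Qed.

Theorem theorem2 (R : realType) (I J : set R) (h f g : R -> R) (a b : R)
  (itvI : is_interval I)
  (sJ : `[0, 1] `<=` J)
  (h_superadd : superadditive J h)
  (h_ge0 : forall x, J x -> 0 <= h x)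
  (h_ge_id : forall t, 0 < t < 1 -> t <= h t)
  (f_SX : h_convex h I f)
  (g_SX : h_convex h I g)
  (fg_so : similarly_ordered I f g)
  (Ia : I a) (Ib : I b) (ltab : a < b) :
  M f g a b / 6 + N f g a b / 3 <=
  h 1 * (f a * g a * (\int[lebesgue_measure]_(t in `[0, 1]) h t)
       + f b * g b * (\int[lebesgue_measure]_(t in `[0, 1]) h (1 - t))).
Proof.
have h_homo := superadditive_nondecreasing _ _ _ sJ h_superadd h_ge0.
have h1_ge1 := nondecreasing_ge1 _ _ h_homo h_ge_id.
(* At [0] the bound is the nonnegativity of [h], at [1] it is [h1_ge1]. *)
have h_ge_id01 (t : R) : t \in `[0, 1] -> t <= h t.
  rewrite in_itv /= => /andP[]; rewrite le_eqVlt => /predU1P[<- _|t_gt0].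
    by apply/h_ge0/sJ; rewrite /= in_itv /= lexx ler01.
  by rewrite le_eqVlt => /predU1P[->//|t_lt1]; apply: h_ge_id; rewrite t_gt0.
have int_h : 2^-1 <= \int[lebesgue_measure]_(t in `[0, 1]) h t.
  rewrite -Rintegral_id; apply: le_Rintegral => //.
  - exact: (nondecreasing_integrable _ id).
  - exact: nondecreasing_integrable.
have int_h_onem : 2^-1 <= \int[lebesgue_measure]_(t in `[0, 1]) h (1 - t).
  rewrite -Rintegral_onem; apply: le_Rintegral => //.
  - exact: (nondecreasing_onem_integrable _ id).
  - exact: nondecreasing_onem_integrable.
  - move=> t; rewrite /= in_itv /= => t01.
    by apply: h_ge_id01; rewrite in_itv /=; lra.
have [[f_ge0 _] [g_ge0 _]] := (f_SX, g_SX).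
have A_ge0 : 0 <= f a * g a by rewrite mulr_ge0 ?f_ge0 ?g_ge0.
have B_ge0 : 0 <= f b * g b by rewrite mulr_ge0 ?f_ge0 ?g_ge0.
have N_le_M : N f g a b <= M f g a b.
  by have := fg_so _ _ Ia Ib; rewrite /N /M; lra.
apply: (@le_trans _ _ (M f g a b / 2)); first by lra.
have M_le : M f g a b / 2 <=
    f a * g a * (\int[lebesgue_measure]_(t in `[0, 1]) h t)
  + f b * g b * (\int[lebesgue_measure]_(t in `[0, 1]) h (1 - t)).
  by rewrite /M mulrDl lerD// ler_wpM2l.
apply: le_trans M_le _; rewrite ler_peMl//.
by rewrite addr_ge0// mulr_ge0//; lra.
Qed.
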